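(* Up to isomorphism, there exist exactly $77$ pairwise nonisomorphic three-element doppelsemigroups, of which exactly $41$ are commutative. The noncommutative three-element doppelsemigroups form, up to isomorphism, $18$ pairs of dual doppelsemigroups (that is, the $36$ isomorphism classes of noncommutative three-element doppelsemigroups split into $18$ pairs of distinct classes, each pair consisting of the class of some $(D,\dashv,\vdash)$ and the class of its dual $(D,\dashv,\vdash)^{d}$). Moreover, up to isomorphism there are exactly $65$ strong doppelsemigroups of order $3$. Furthermore, up to isomorphism there are exactly $7$ rectangular doppelsemigroups of order $3$: one commutative trivial doppelsemigroup, two pairs of noncommutative trivial dual doppelsemigroups, and a single pair of noncommutative iso-opposite nontrivial dual doppelsemigroups. Additionally, there exist exactly $24$ pairwise nonisomorphic three-element trivial doppelsemigroups.
   Context: A doppelsemigroup $(D,\dashv,\vdash)$ is a set $D$ with two associative binary operations $\dashv,\vdash$ satisfying $(x\dashv y)\vdash z=x\dashv(y\vdash z)$ and $(x\vdash y)\dashv z=x\vdash(y\dashv z)$ for all $x,y,z\in D$. It is trivial if the operations $\dashv$ and $\vdash$ coincide (nontrivial otherwise); commutative if both $\dashv$ and $\vdash$ are commutative (noncommutative otherwise); strong if $x\dashv(y\vdash z)=x\vdash(y\dashv z)$ for all $x,y,z\in D$; rectangular if $x\dashv y\dashv z=x\dashv z$ and $x\vdash y\vdash z=x\vdash z$ for all $x,y,z\in D$. An isomorphism of doppelsemigroups is a bijection $\psi:D_1\to D_2$ with $\psi(a\dashv_1 b)=\psi(a)\dashv_2\psi(b)$ and $\psi(a\vdash_1 b)=\psi(a)\vdash_2\psi(b)$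 for all $a,b\in D_1$. Put $x\dashv^d y=y\dashv x$ and $x\vdash^d y=y\vdash x$. The dual of $(D,\dashv,\vdash)$ is the doppelsemigroup $(D,\dashv,\vdash)^{d}=(D,\dashv^d,\vdash^d)$, and its opposite is the doppelsemigroup $(D,\dashv,\vdash)^{op}=(D,\vdash,\dashv)$. A doppelsemigroup is iso-opposite if it is isomorphic to its opposite. The order of a doppelsemigroup is the cardinality of $D$. *)

(* Defs.v *)
From mathcomp Require Import all_boot.

Set Implicit Arguments.
Unset Strict Implicit.
Unset Printing Implicit Defensive.

Record doppelsemigroup : Type := Doppelsemigroup {
  carrier :> Type;
  dl : carrier -> carrier -> carrier;
  dr : carrier -> carrier -> carrier;
  dlA : associative dl;
  drA : associative dr;
  dlr : forall x y z, dr (dl x y) z = dl x (dr y z);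
  drl : forall x y z, dl (dr x y) z = dr x (dl y z)
}.

Notation "x ⊣ y" := (dl x y) (at level 40, left associativity).
Notation "x ⊢ y" := (dr x y) (at level 40, left associativity).

Definition trivial (D : doppelsemigroup) : Prop :=
  forall x y : D, x ⊣ y = x ⊢ y.

Definition commutative_dsg (D : doppelsemigroup) : Prop :=
  commutative (@dl D) /\ commutative (@dr D).

Definition strong (D : doppelsemigroup) : Prop :=
  forall x y z : D, x ⊣ (y ⊢ z) = x ⊢ (y ⊣ z).

Definition rectangular (D : doppelsemigroup) : Prop :=
  (forall x y z : D, x ⊣ y ⊣ z = x ⊣ z) /\
  (forall x y z : D, x ⊢ y ⊢ z = x ⊢ z).

Definition isomorphic (D1 D2 : doppelsemigroup) : Prop :=
  exists psi : D1 -> D2,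
    [/\ bijective psi,
        forall a b : D1, psi (a ⊣ b) = psi a ⊣ psi b
      & forall a b : D1, psi (a ⊢ b) = psi a ⊢ psi b].

Definition dual (D : doppelsemigroup) : doppelsemigroup :=
  @Doppelsemigroup D (fun x y => y ⊣ x) (fun x y => y ⊢ x)
    (fun x y z => esym (dlA z y x))
    (fun x y z => esym (drA z y x))
    (fun x y z => esym (drl z y x))
    (fun x y z => esym (dlr z y x)).

Definition opposite (D : doppelsemigroup) : doppelsemigroup :=
  @Doppelsemigroup D (@dr D) (@dl D) (@drA D) (@dlA D) (@drl D) (@dlr D).

Definition iso_opposite (D : doppelsemigroup) : Prop :=
  isomorphic D (opposite D).

Definition has_order (n : nat) (D : doppelsemigroup) : Prop :=
  exists f : 'I_n -> D, bijective f.

(* [S] is a system of representatives, without repetition, of the isomorphism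
   classes of the doppelsemigroups satisfying [P]. *)
Definition represents (I : Type) (P : doppelsemigroup -> Prop)
    (S : I -> doppelsemigroup) : Prop :=
  [/\ forall i, P (S i),
      forall i j, isomorphic (S i) (S j) -> i = j
    & forall D, P D -> exists i, isomorphic D (S i)].

Definition num_iso_classes (P : doppelsemigroup -> Prop) (n : nat) : Prop :=
  exists S : 'I_n -> doppelsemigroup, represents P S.

(* The isomorphism classes of the doppelsemigroups satisfying [P] are the
   2 * n distinct classes of S_0, dual S_0, ..., S_(n-1), dual S_(n-1). *)
Definition num_dual_pairs (P : doppelsemigroup -> Prop) (n : nat) : Prop :=
  exists S : 'I_n -> doppelsemigroup,
    represents P (fun p : 'I_n * bool => if p.2 then dual (S p.1) else S p.1).

(* Main.v *)
Require Import Defs.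
From mathcomp Require Import all_boot.

Set Implicit Arguments.
Unset Strict Implicit.
Unset Printing Implicit Defensive.

(** The theorem is a finite computation, organised as follows. A
    doppelsemigroup of order 3 can be carried over to the set [three = option
    bool], where it is given by a code, i.e. a pair of Cayley tables
    ([encode]). Listing all pairs of tables that satisfy the four laws, and
    keeping a code only if it is not isomorphic to one already kept, gives a
    list [classes] of representatives of all isomorphism classes
    ([classes_cover], [transversal_pairwise]).

    Commutativity, strength and the other properties are invariant under
    isomorphism and amount to a boolean test on codes ([detects]), so the
    number of isomorphism classes with such a property is the number of
    members of [classes] that pass the test ([num_iso_classes_count]).

    For the dual pairs, the list is thinned out once more, identifying a code
    with its dual. One member of each pair is left, and its dual accounts for
    the other class, as long as no code in the list is isomorphic to its own
    dual ([num_dual_pairs_count]); this too is tested on [classes]. What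
    remains is the evaluation of closed natural numbers and booleans. *)

(** * Isomorphism of doppelsemigroups *)

Lemma isomorphic_refl D : isomorphic D D.
Proof. by exists id; split=> //; exists id. Qed.

Lemma isomorphic_sym D E : isomorphic D E -> isomorphic E D.
Proof.
case=> f [[g fK gK] fl fr]; exists g; split; first by exists f.
- by move=> a b; rewrite -{1}(gK a) -{1}(gK b) -fl fK.
- by move=> a b; rewrite -{1}(gK a) -{1}(gK b) -fr fK.
Qed.

Lemma isomorphic_trans D E F :
  isomorphic D E -> isomorphic E F -> isomorphic D F.
Proof.
case=> f [fB fl fr] [g [gB gl gr]]; exists (g \o f).
by split=> [|a b|a b] /=; rewrite ?fl ?gl ?fr ?gr //; apply: bij_comp.
Qed.

Lemma isomorphic_dual D E : isomorphic D E -> isomorphic (dual D) (dual E).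
Proof.
by case=> f [fB fl fr]; exists f; split=> // a b; [apply: fl|apply: fr].
Qed.

Lemma isomorphic_opposite D E :
  isomorphic D E -> isomorphic (opposite D) (opposite E).
Proof. by case=> f [fB fl fr]; exists f; split. Qed.

(** Duality is an involution: the double dual of D has the operations of D. *)
Lemma isomorphic_dualC D E : isomorphic (dual D) E -> isomorphic D (dual E).
Proof. by move/isomorphic_dual; apply. Qed.

(** * Irredundant sublists *)

Section Transversal.

Variables (T : eqType) (r : rel T).

(** One element of every class, when [r] is an equivalence relation.  A greedy
    filter suits evaluation: it compares elements only with those already kept,
    and needs no canonical form for a class. *)
Definition transversal : seq T -> seq T :=
  foldr (fun x t => if has (r x) t then t else x :: t) [::].

Lemma transversal_sub s : {subset transversal s <= s}.
Proof.
elim: s => //= x s IH y; case: ifP => _; rewrite !inE.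
  by move/IH->; rewrite orbT.
by case/orP=> [->//|/IH->]; rewrite orbT.
Qed.

Lemma transversal_pairwise s : pairwise (fun x y => ~~ r x y) (transversal s).
Proof.
by elim: s => //= x s IH; case: ifP => //= /negbT; rewrite -all_predC => ->.
Qed.

Lemma transversal_cover s x : r x x -> x \in s -> has (r x) (transversal s).
Proof.
move=> rxx; elim: s => //= y s IH; rewrite inE => /predU1P[<-|/IH].
  by case: ifP => //= _; rewrite rxx.
by case: ifP => //= _ ->; rewrite orbT.
Qed.

(** [pairwise] only forbids [r] between an element and a later one, whence the
    need for symmetry. *)
Lemma pairwise_nth_inj (x0 : T) s i j :
    {in s &, symmetric r} -> pairwise (fun x y => ~~ r x y) s ->
    i < size s -> j < size s -> r (nth x0 s i) (nth x0 s j) -> i = j.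
Proof.
move=> r_sym /(pairwiseP x0) s_r lti ltj rij.
case: (ltngtP i j) => // [ltij|ltji].
  by have := s_r _ _ lti ltj ltij; rewrite rij.
by have := s_r _ _ ltj lti ltji; rewrite r_sym ?mem_nth // rij.
Qed.

End Transversal.

(** * Cayley tables on three elements *)

(** Unlike those of ['I_3], the elements carry no proofs, and functions on this
    type reduce by mere case analysis. *)
Notation three := (option bool).

(** Replaces the boolean quantifiers over finite types, which are locked and so
    do not reduce. *)
Definition every (p : pred three) : bool :=
  [&& p None, p (Some false) & p (Some true)].

Lemma everyP (p : pred three) : reflect (forall x, p x) (every p).
Proof.
by apply: (iffP and3P) => [[p0 p1 p2] [[]|]|p_all].
Qed.

Lemma every2P (p : three -> pred three) :
  reflect (forall x y, p x y) (every (fun x => every (p x))).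
Proof. by apply: (iffP (everyP _)) => p_all x; apply/everyP. Qed.

Lemma every3P (p : three -> three -> pred three) :
  reflect (forall x y z, p x y z)
          (every (fun x => every (fun y => every (p x y)))).
Proof. by apply: (iffP (everyP _)) => p_all x; apply/every2P. Qed.

(** A function on [three] stored as its three values, so that functions can be
    listed, compared and computed with. *)
Definition triple (T : Type) : Type := (T * T * T)%type.

Definition entry T (t : triple T) (x : three) : T :=
  match x with
  | None => t.1.1
  | Some false => t.1.2
  | Some true => t.2
  end.

Definition tabulate T (f : three -> T) : triple T :=
  (f None, f (Some false), f (Some true)).

Lemma entry_tabulate T (f : three -> T) : entry (tabulate f) =1 f.
Proof. by case=> [[]|]. Qed.

Definition triples (T : Type) (s : seq T) : seq (triple T) :=
  [seq (ab, c) | ab <- [seq (a, b) | a <- s, b <- s], c <- s].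

Lemma mem_triples (T : eqType) (s : seq T) (t : T * T * T) :
  (forall x, x \in s) -> t \in triples s.
Proof.
case: t => [[a b] c] s_all.
by apply: allpairs_f => //; apply: allpairs_f.
Qed.

Definition elements : seq three := [:: None; Some false; Some true].

Lemma mem_elements x : x \in elements.
Proof. by case: x => [[]|]. Qed.

(** The type [triple (triple three)], spelled out so that its decidable equality
    is inferred from that of products. *)
Notation table := (three * three * three * (three * three * three)
                     * (three * three * three))%type.
Notation code := (table * table)%type.

Definition op (t : table) (x y : three) : three := entry (entry t x) y.

Definition table_of (f : three -> three -> three) : table :=
  tabulate (fun x => tabulate (f x)).

Lemma op_table f x y : op (table_of f) x y = f x y.
Proof. by rewrite /op !entry_tabulate. Qed.

Lemma three_bij : exists h : three -> 'I_3, bijective h.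
Proof.
exists (fun x => inord (index x elements)).
exists (fun i : 'I_3 => nth None elements i).
  by case=> [[]|]; rewrite inordK.
by case=> [[|[|[|//]]] lt_i3]; apply: val_inj; rewrite /= inordK.
Qed.

(** * Doppelsemigroups given by a pair of tables *)

Definition associative_table (t : table) : bool :=
  every (fun x => every (fun y => every (fun z =>
    op t x (op t y z) == op t (op t x y) z))).

Definition compatible (c : code) : bool :=
  every (fun x => every (fun y => every (fun z =>
    (op c.2 (op c.1 x y) z == op c.1 x (op c.2 y z)) &&
    (op c.1 (op c.2 x y) z == op c.2 x (op c.1 y z))))).

Definition valid (c : code) : bool :=
  [&& associative_table c.1, associative_table c.2 & compatible c].

Lemma validP (c : code) :
  reflect [/\ associative (op c.1), associative (op c.2),
              forall x y z, op c.2 (op c.1 x y) z = op c.1 x (op c.2 y z)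
            & forall x y z, op c.1 (op c.2 x y) z = op c.2 x (op c.1 y z)]
          (valid c).
Proof.
rewrite /valid /associative_table /compatible; apply: (iffP and3P).
  case=> /every3P A1 /every3P A2 /every3P A3.
  split=> x y z; [exact/eqP/A1|exact/eqP/A2| |].
    by case/andP: (A3 x y z) => /eqP.
  by case/andP: (A3 x y z) => _ /eqP.
case=> A1 A2 A3 A4; split; apply/every3P => x y z.
- exact/eqP/A1.
- exact/eqP/A2.
- by rewrite A3 A4 !eqxx.
Qed.

Definition decode (c : code) (v : valid c) : doppelsemigroup :=
  @Doppelsemigroup three (op c.1) (op c.2)
    (let: And4 H _ _ _ := elimT (validP c) v in H)
    (let: And4 _ H _ _ := elimT (validP c) v in H)
    (let: And4 _ _ H _ := elimT (validP c) v in H)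
    (let: And4 _ _ _ H := elimT (validP c) v in H).

Lemma order_decode c (v : valid c) : has_order 3 (decode v).
Proof. by have [h [k hK kK]] := three_bij; exists k; exists h. Qed.

(** Transport of both operations along a bijection between D and [three]. *)
Lemma encode D :
  has_order 3 D -> exists c, exists v : valid c, isomorphic D (decode v).
Proof.
case=> f f_bij; have [h h_bij] := three_bij.
have [g gK Kg] : bijective (f \o h) by exact: bij_comp.
pose F := f \o h; rewrite -/F in gK Kg.
pose c := (table_of (fun x y => g (F x ⊣ F y)),
           table_of (fun x y => g (F x ⊢ F y))).
have v : valid c.
  by apply/validP; split=> x y z /=; rewrite !op_table !Kg ?dlA ?drA ?dlr ?drl.
exists c, v, g; split=> [|a b|a b]; first by exists F.
  by rewrite /= op_table !Kg.
by rewrite /= op_table !Kg.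
Qed.

Definition dual_code (c : code) : code :=
  (table_of (fun x y => op c.1 y x), table_of (fun x y => op c.2 y x)).

Lemma valid_dual c : valid c -> valid (dual_code c).
Proof.
case/validP=> A1 A2 A12 A21; apply/validP.
by split=> x y z /=; rewrite !op_table.
Qed.

(** The operations agree pointwise only, since one side reads its values off the
    transposed table: hence an isomorphism in place of an equality. *)
Lemma dual_decode c (v : valid c) (w : valid (dual_code c)) :
  isomorphic (decode w) (dual (decode v)).
Proof. by exists id; split=> [|a b|a b]; [exists id|rewrite /= op_table..]. Qed.

(** * Deciding isomorphism *)

Definition bijections : seq (triple three) :=
  [seq s <- triples elements | uniq [:: s.1.1; s.1.2; s.2]].

Lemma mem_bijections (s : three * three * three) :
  reflect (bijective (entry s)) (s \in bijections).
Proof.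
rewrite mem_filter mem_triples ?andbT; last exact: mem_elements.
case: s => [[a b] c] /=; apply: (iffP idP) => [|/bij_inj s_inj].
  rewrite !inE negb_or andbT => /andP[/andP[/eqP ab /eqP ac] /eqP bc].
  by apply: injF_bij => -[[]|] [[]|] //= /esym // /esym.
have neq x y : x != y -> entry (a, b, c) x != entry (a, b, c) y.
  by rewrite (inj_eq s_inj).
rewrite !inE negb_or andbT (neq None (Some false)) //.
by rewrite (neq None (Some true)) // (neq (Some false) (Some true)).
Qed.

Definition morphism (s : triple three) (t u : table) : bool :=
  every (fun x => every (fun y =>
    entry s (op t x y) == op u (entry s x) (entry s y))).

Lemma morphismP s t u :
  reflect {morph entry s : x y / op t x y >-> op u x y} (morphism s t u).
Proof. by apply: (iffP (every2P _)) => H x y; apply/eqP/H. Qed.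

Definition iso_code (c d : code) : bool :=
  has (fun s => morphism s c.1 d.1 && morphism s c.2 d.2) bijections.

Lemma iso_codeP c d (v : valid c) (w : valid d) :
  reflect (isomorphic (decode v) (decode w)) (iso_code c d).
Proof.
apply: (iffP hasP) => [[s /mem_bijections s_bij]|].
  by case/andP=> /morphismP s1 /morphismP s2; exists (entry s).
case=> f [f_bij f1 f2]; exists (tabulate f).
  by apply/mem_bijections/(eq_bij f_bij) => x; rewrite entry_tabulate.
apply/andP; split; apply/morphismP => x y; rewrite !entry_tabulate.
  exact: f1.
exact: f2.
Qed.

Lemma iso_code_refl c : valid c -> iso_code c c.
Proof. by move=> v; apply/(iso_codeP v v)/isomorphic_refl. Qed.

Lemma iso_code_sym : {in valid &, symmetric iso_code}.
Proof.
move=> c d v w; apply: (sameP (iso_codeP v w)).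
by apply: (iffP (iso_codeP w v)) => /isomorphic_sym.
Qed.

Definition iso_dual_code (c d : code) : bool :=
  iso_code c d || iso_code c (dual_code d).

Lemma iso_dual_codeP c d (v : valid c) (w : valid d) :
  reflect (isomorphic (decode v) (decode w) \/
           isomorphic (decode v) (dual (decode w)))
          (iso_dual_code c d).
Proof.
have w' := valid_dual w.
have dual_w := dual_decode w w'.
apply: (iffP orP) => -[c_d|c_d].
- by left; apply/(iso_codeP v w).
- by right; apply: isomorphic_trans dual_w; apply/(iso_codeP v w').
- by left; apply/(iso_codeP v w).
- right; apply/(iso_codeP v w')/(isomorphic_trans c_d).
  exact: isomorphic_sym.
Qed.

Lemma iso_dual_code_sym : {in valid &, symmetric iso_dual_code}.
Proof.
move=> c d v w; apply: (sameP (iso_dual_codeP v w)).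
apply: (iffP (iso_dual_codeP w v)) => -[] /isomorphic_sym H.
- by left.
- by right; apply: isomorphic_dualC.
- by left.
- by right; apply: isomorphic_dualC.
Qed.

(** * The classification *)

Definition semigroup_tables : seq table :=
  [seq t <- triples (triples elements) | associative_table t].

(** Associativity is tested on single tables first: only 113 of the [3 ^ 9]
    tables pass, so that it is possible to run through their pairs. *)
Definition valid_codes : seq code :=
  [seq c <- [seq (t, u) | t <- semigroup_tables, u <- semigroup_tables]
     | compatible c].

Lemma mem_valid_codes c : (c \in valid_codes) = valid c.
Proof.
have mem_semi s : (s \in semigroup_tables) = associative_table s.
  rewrite mem_filter mem_triples ?andbT // => r.
  exact/mem_triples/mem_elements.
rewrite mem_filter andbC /valid andbA; congr andb.
apply/allpairsP/andP => [[[a b] [Ha Hb ->]]|[H1 H2]].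
  by rewrite -!mem_semi.
by exists c; rewrite !mem_semi H1 H2; case: c {H1 H2}.
Qed.

Definition classes : seq code := transversal iso_code valid_codes.

Lemma valid_classes c : c \in classes -> valid c.
Proof. by move/transversal_sub; rewrite mem_valid_codes. Qed.

Lemma classes_cover D : has_order 3 D ->
  exists c, exists2 v : valid c, c \in classes & isomorphic D (decode v).
Proof.
move=> /encode[c [v D_c]].
have: has (iso_code c) classes.
  by apply: transversal_cover; [exact: iso_code_refl|rewrite mem_valid_codes].
move=> /hasP[d d_in c_d]; have w := valid_classes d_in; exists d, w.
  exact: d_in.
exact: isomorphic_trans D_c (elimT (iso_codeP v w) c_d).
Qed.

(** * Counting the classes with a given property *)

Definition invariant (P : doppelsemigroup -> Prop) : Prop :=
  forall D E, isomorphic D E -> P D -> P E.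

(** The link between the theorem and its computation: once [P] is invariant, its
    truth for any D can be read off the code that represents the class of D. *)
Definition detects (p : pred code) (P : doppelsemigroup -> Prop) : Prop :=
  invariant P /\ forall c (v : valid c), P (decode v) <-> p c.

Lemma detects_and p q P Q : detects p P -> detects q Q ->
  detects (predI p q) (fun D => P D /\ Q D).
Proof.
move=> [P_iso pP] [Q_iso qQ]; split=> [D E D_E [/P_iso PE /Q_iso QE]|c v] /=.
  by split; [apply: PE|apply: QE].
by split=> [[/pP -> /qQ ->]|/andP[/pP ? /qQ ?]].
Qed.

Lemma detects_not p P : detects p P -> detects (predC p) (fun D => ~ P D).
Proof.
move=> [P_iso pP]; split=> [D E D_E nPD|c v].
  by move/(P_iso _ _ (isomorphic_sym D_E)).
by split=> [nP|/negP np /pP//]; apply/negP => /pP.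
Qed.

Lemma detects_order : detects xpredT (has_order 3).
Proof.
split=> [D E [f [f_bij _ _]] [g g_bij]|c v].
  by exists (f \o g); apply: bij_comp.
by split=> // _; apply: order_decode.
Qed.

Definition trivial_code (c : code) : bool :=
  every (fun x => every (fun y => op c.1 x y == op c.2 x y)).

Lemma detects_trivial : detects trivial_code trivial.
Proof.
split=> [D E [f [[g fK gK] fl fr]] D_triv x y|c v]; rewrite /trivial_code.
  by rewrite -(gK x) -(gK y) -fl -fr D_triv.
split=> [c_triv|/every2P c_triv x y]; last exact/eqP/c_triv.
by apply/every2P => x y; apply/eqP/c_triv.
Qed.

Definition commutative_code (c : code) : bool :=
  every (fun x => every (fun y =>
    (op c.1 x y == op c.1 y x) && (op c.2 x y == op c.2 y x))).

Lemma detects_commutative : detects commutative_code commutative_dsg.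
Proof.
split=> [D E [f [[g fK gK] fl fr]] [lC rC]|c v]; rewrite /commutative_code.
  by split=> x y; rewrite -(gK x) -(gK y) -?fl -?fr (lC, rC).
split=> [[lC rC]|/every2P c_comm].
  apply/every2P => x y; apply/andP.
  by split; apply/eqP; [apply: lC|apply: rC].
by split=> x y; case/andP: (c_comm x y) => /eqP ? /eqP.
Qed.

Definition strong_code (c : code) : bool :=
  every (fun x => every (fun y => every (fun z =>
    op c.1 x (op c.2 y z) == op c.2 x (op c.1 y z)))).

Lemma detects_strong : detects strong_code strong.
Proof.
split=> [D E [f [[g fK gK] fl fr]] D_strong x y z|c v]; rewrite /strong_code.
  by rewrite -(gK x) -(gK y) -(gK z) -!(fl, fr) D_strong.
split=> [c_strong|/every3P c_strong x y z]; last exact/eqP/c_strong.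
by apply/every3P => x y z; apply/eqP/c_strong.
Qed.

Definition rectangular_code (c : code) : bool :=
  every (fun x => every (fun y => every (fun z =>
    (op c.1 (op c.1 x y) z == op c.1 x z) &&
    (op c.2 (op c.2 x y) z == op c.2 x z)))).

Lemma detects_rectangular : detects rectangular_code rectangular.
Proof.
split=> [D E [f [[g fK gK] fl fr]] [lR rR]|c v]; rewrite /rectangular_code.
  by split=> x y z; rewrite -(gK x) -(gK y) -(gK z) -!(fl, fr) (lR, rR).
split=> [[lR rR]|/every3P c_rect].
  apply/every3P => x y z; apply/andP.
  by split; apply/eqP; [apply: lR|apply: rR].
by split=> x y z; case/andP: (c_rect x y z) => /eqP ? /eqP.
Qed.

Definition iso_opposite_code (c : code) : bool := iso_code c (c.2, c.1).

Lemma detects_iso_opposite : detects iso_opposite_code iso_opposite.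
Proof.
split=> [D E D_E D_op|c v].
  apply: isomorphic_trans (isomorphic_opposite D_E).
  exact: isomorphic_trans (isomorphic_sym D_E) D_op.
have w : valid (c.2, c.1) by case/validP: v => A1 A2 A12 A21; apply/validP.
split=> [c_op|/(iso_codeP v w)//].
exact/(iso_codeP v w).
Qed.

Section Counting.

Variables (p : pred code) (P : doppelsemigroup -> Prop).
Hypotheses (p_P : detects p P) (P_order : forall D, P D -> has_order 3 D).

Let s : seq code := filter p classes.

Lemma code_with_property c : c \in s -> p c /\ valid c.
Proof. by rewrite mem_filter => /andP[pc /valid_classes]. Qed.

Lemma classes_cover_with D :
  P D -> exists c, exists2 v : valid c, c \in s & isomorphic D (decode v).
Proof.
move=> PD; have [c [v c_in D_c]] := classes_cover (P_order PD).
exists c, v; last exact: D_c.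
rewrite mem_filter c_in andbT.
by apply/(proj2 p_P c v)/(proj1 p_P _ _ D_c).
Qed.

(** The members of [classes] that pass the test are pairwise nonisomorphic, as
    [classes] is, and every D satisfying [P] is isomorphic to one of them. *)
Lemma num_iso_classes_count n : count p classes = n -> num_iso_classes P n.
Proof.
move=> <-; rewrite -size_filter -/s.
pose c0 : code := (table_of (fun x _ => x), table_of (fun x _ => x)).
have in_s (i : 'I_(size s)) : nth c0 s i \in s by apply: mem_nth.
pose v i := proj2 (code_with_property (in_s i)).
exists (fun i => decode (v i)); split=> [i|i j ij|D /classes_cover_with].
- exact/(proj2 p_P)/(proj1 (code_with_property (in_s i))).
- apply/val_inj/(@pairwise_nth_inj _ iso_code c0 s).
  + move=> c d /code_with_property[_ vc] /code_with_property[_ vd].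
    exact: iso_code_sym.
  + exact/pairwise_filter/transversal_pairwise.
  + exact: ltn_ord.
  + exact: ltn_ord.
  + exact/(iso_codeP (v i) (v j)).
case=> c [w c_s D_c].
have lt_i : index c s < size s by rewrite index_mem.
exists (Ordinal lt_i); apply: isomorphic_trans D_c _.
by apply/iso_codeP; rewrite (nth_index _ c_s); apply: iso_code_refl.
Qed.

(** The classes of C_i and dual C_i, for C_i in the thinned list, exhaust the
    classes with the property [P].  If two of them coincide then their indices
    agree, since the list is irredundant up to isomorphism and duality; and then
    they are not C_i and its dual, since no code of the list is self-dual up to
    isomorphism. *)
Lemma num_dual_pairs_count n :
    all (fun c => p (dual_code c) && ~~ iso_code c (dual_code c)) s ->
  size (transversal iso_dual_code s) = n -> num_dual_pairs P n.
Proof.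
move=> s_dual <-.
have t_cover c (vc : valid c) (c_s : c \in s) :
    has (iso_dual_code c) (transversal iso_dual_code s).
  refine (transversal_cover _ c_s).
  by rewrite /iso_dual_code iso_code_refl.
move: (@transversal_sub _ iso_dual_code s) t_cover
  (transversal_pairwise iso_dual_code s).
move: (transversal _ _) => t t_sub t_cover t_pairwise.
pose c0 : code := (table_of (fun x _ => x), table_of (fun x _ => x)).
have in_s (i : 'I_(size t)) : nth c0 t i \in s by apply/t_sub/mem_nth.
pose v i := proj2 (code_with_property (in_s i)).
pose w i := valid_dual (v i).
have not_self_dual i : ~ isomorphic (decode (v i)) (dual (decode (v i))).
  move=> H; have /andP[_ /negP] := allP s_dual _ (in_s i); apply.
  apply/(iso_codeP (v i) (w i))/(isomorphic_trans H).
  exact/isomorphic_sym/dual_decode.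
exists (fun i => decode (v i)); split=> [[i []] /=|[i b] [j b'] /= ij|D PD].
- apply: (proj1 p_P) (dual_decode (v i) (w i)) _; apply/(proj2 p_P).
  by have /andP[] := allP s_dual _ (in_s i).
- exact/(proj2 p_P)/(proj1 (code_with_property (in_s i))).
- have eq_ij : i = j.
    apply/val_inj/(@pairwise_nth_inj _ iso_dual_code c0 t).
    + move=> c d /t_sub/code_with_property[_ vc].
      move=> /t_sub/code_with_property[_ vd].
      exact: iso_dual_code_sym.
    + exact: t_pairwise.
    + exact: ltn_ord.
    + exact: ltn_ord.
    + apply/(iso_dual_codeP (v i) (v j)).
      case: b b' ij => [] [] ij.
      * by left; apply: (isomorphic_dualC ij).
      * by right; apply: isomorphic_dualC.
      * by right.
      * by left.
  move: ij; rewrite -eq_ij; case: b b' => [] [] ij; [by []| | |by []].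
    by case: (not_self_dual i); apply: isomorphic_dualC ij.
  by case: (not_self_dual i); apply: ij.
have [c [vc c_s D_c]] := classes_cover_with PD.
case/(has_nthP c0): (t_cover _ vc c_s) => k lt_k.
case/(iso_dual_codeP vc (v (Ordinal lt_k))) => c_k.
  by exists (Ordinal lt_k, false); apply: isomorphic_trans D_c c_k.
by exists (Ordinal lt_k, true); apply: isomorphic_trans D_c c_k.
Qed.

End Counting.

Theorem theorem6p1 :
  num_iso_classes (has_order 3) 77 /\
  num_iso_classes (fun D => has_order 3 D /\ commutative_dsg D) 41 /\
  num_iso_classes (fun D => has_order 3 D /\ ~ commutative_dsg D) 36 /\
  num_dual_pairs (fun D => has_order 3 D /\ ~ commutative_dsg D) 18 /\
  num_iso_classes (fun D => has_order 3 D /\ strong D) 65 /\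
  num_iso_classes (fun D => has_order 3 D /\ rectangular D) 7 /\
  num_iso_classes (fun D => has_order 3 D /\ rectangular D /\
                            commutative_dsg D /\ trivial D) 1 /\
  num_dual_pairs (fun D => has_order 3 D /\ rectangular D /\
                           ~ commutative_dsg D /\ trivial D) 2 /\
  num_dual_pairs (fun D => has_order 3 D /\ rectangular D /\
                           ~ commutative_dsg D /\ iso_opposite D /\
                           ~ trivial D) 1 /\
  num_iso_classes (fun D => has_order 3 D /\ trivial D) 24.
Proof.
have O := detects_order; have R := detects_rectangular.
have C := detects_commutative; have NC := detects_not C.
have T := detects_trivial; have NT := detects_not T.
have RCT := detects_and R (detects_and C T).
have RNT := detects_and R (detects_and NC T).
have RNI := detects_and R (detects_and NC (detects_and detects_iso_opposite NT)).
have S := detects_strong.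
(* Each use leaves the inclusion into order 3, and the tests on [classes]. *)
do 9?split.
- by apply: (num_iso_classes_count O); vm_compute.
- by apply: (num_iso_classes_count (detects_and O C)) => [D []|]; vm_compute.
- by apply: (num_iso_classes_count (detects_and O NC)) => [D []|]; vm_compute.
- by apply: (num_dual_pairs_count (detects_and O NC)) => [D []||]; vm_compute.
- by apply: (num_iso_classes_count (detects_and O S)) => [D []|]; vm_compute.
- by apply: (num_iso_classes_count (detects_and O R)) => [D []|]; vm_compute.
- by apply: (num_iso_classes_count (detects_and O RCT)) => [D []|]; vm_compute.
- by apply: (num_dual_pairs_count (detects_and O RNT)) => [D []||]; vm_compute.
- by apply: (num_dual_pairs_count (detects_and O RNI)) => [D []||]; vm_compute.
- by apply: (num_iso_classes_count (detects_and O T)) => [D []|]; vm_compute.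
Qed.
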